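(* Let $\phi:\mathbb{P}_k^m\dashrightarrow\mathbb{P}_k^n$ be a rational map, generically finite onto its image, given by homogeneous polynomials $f_0,\ldots,f_n\in R=k[X_0,\ldots,X_m]$ of the same degree $d$ with $\gcd(f_0,\ldots,f_n)=1$, and let $I=(f_0,\ldots,f_n)$. If there exists an integer $s\geq 1$ such that $\nu:=\operatorname{indeg}((I^s)^{\mathrm{sat}})<sd$, then $$\sum_{y\in\mathcal{Y}_{m-1}}\deg(h_y)\leq \nu<sd.$$ In particular, if $\operatorname{indeg}(I^{\mathrm{sat}})<d$, then $$\sum_{y\in\mathcal{Y}_{m-1}}\deg(h_y)<d.$$
   Context: Setting: $k$ is an algebraically closed field, $n\geq m\geq 2$ and $d\geq 1$ are integers, $R=k[X_0,\ldots,X_m]$ is the standard graded polynomial ring with homogeneous maximal ideal $\mathfrak{m}=(X_0,\ldots,X_m)$. The polynomials $f_0,\ldots,f_n\in R_d$ are not all zero and have gcd $1$, and $\phi(x)=(f_0(x):\cdots:f_n(x))$. ''Generically finite onto its image'' means that the closed image of $\phi$ has dimension $m$. Let $\Gamma\subset\mathbb{P}_k^m\times\mathbb{P}_k^n$ be the Zariski closure of the graph of $\phi:\mathbb{P}_k^m\setminus \operatorname{Proj}(R/I)\to\mathbb{P}_k^n$; it is the subscheme defined by the bigraded Rees algebra $\mathcal{R}_I=\bigoplus_{s\geq 0}I^s$, viewed as a quotient of $R[T_0,\ldots,T_n]$ via $T_i\mapsto f_i$. Let $B=k[T_0,\ldots,T_n]$ be the homogeneous coordinate ring of $\mathbb{P}^n_k$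 and let $\pi:\Gamma\to\mathbb{P}_k^n$ be the restriction of the second projection. For a closed point $y\in\mathbb{P}_k^n$ with residue field $k(y)\simeq k$, the fiber is $\pi^{-1}(y)=\operatorname{Proj}(\mathcal{R}_I\otimes_B k(y))\subset\mathbb{P}_k^m$. Set $\mathcal{Y}_{m-1}=\{y\in\mathbb{P}_k^n \text{ closed}\mid \dim\pi^{-1}(y)=m-1\}$; this is a finite set. For $y\in\mathcal{Y}_{m-1}$, $h_y\in R$ denotes the homogeneous polynomial (unique up to a nonzero scalar) defining the unmixed part of dimension $m-1$ of $\pi^{-1}(y)$. Explicitly, if $y=(p_0:\cdots:p_n)$ with $p_i=1$, then $h_y=\gcd(f_0-p_0f_i,\ldots,f_n-p_nf_i)$. For an ideal $J\subset R$, $J^{\mathrm{sat}}=J:_R\mathfrak{m}^\infty$. For a graded $R$-module $M$, $\operatorname{indeg}(M)=\inf\{j\in\mathbb{Z}\mid M_j\neq 0\}$ (with value $+\infty$ if $M=0$). *)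

(* Defs.v *)
From HB Require Import structures.
From mathcomp Require Import all_boot all_order all_algebra.
From mathcomp Require Import finmap ring_quotient.
From mathcomp Require Import mpoly.
From Stdlib Require Import ClassicalEpsilon.
Set Implicit Arguments.
Unset Strict Implicit.
Unset Printing Implicit Defensive.
Import GRing.Theory.
Local Open Scope ring_scope.

(* Ideals are Prop-valued predicates, since membership in the ideals below is
   not decidable a priori. *)

Section Divisibility.
Variable R : comNzRingType.

Definition divides (g h : R) : Prop := exists q, h = q * g.

Definition is_gcd (I : Type) (F : I -> R) (g : R) : Prop :=
  (forall i, divides g (F i)) /\
  (forall h, (forall i, divides h (F i)) -> divides h g).

(* A gcd is unique up to a unit; this picks one whenever one exists, hence
   always in a polynomial ring over a field. *)
Definition gcd_of (I : Type) (F : I -> R) : R := epsilon (inhabits 0) (is_gcd F).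

End Divisibility.

Section Ideals.
Variable R : comNzRingType.

Definition ideal_gen (N : nat) (F : 'I_N -> R) (g : R) : Prop :=
  exists c : 'I_N -> R, g = \sum_(i < N) c i * F i.

Definition ideal_mul (J K : R -> Prop) (g : R) : Prop :=
  exists l : seq (R * R),
    (forall ab, ab \in l -> J ab.1 /\ K ab.2) /\ g = \sum_(ab <- l) ab.1 * ab.2.

Definition ideal_exp (J : R -> Prop) (s : nat) : R -> Prop :=
  iter s (ideal_mul J) (fun _ => True).

End Ideals.

Section Graded.
Variables (k : fieldType) (N : nat).
Local Notation S := {mpoly k[N]}.

Definition irrelevant : S -> Prop := ideal_gen (fun i : 'I_N => 'X_i).

Definition sat (J : S -> Prop) (g : S) : Prop :=
  exists e, forall a, ideal_exp irrelevant e a -> J (a * g).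

(* [indeg J nu]: the initial degree of the homogeneous ideal J is the finite
   value nu. It holds for no nu when J = 0, i.e. when indeg(J) = +oo. *)
Definition indeg (J : S -> Prop) (nu : nat) : Prop :=
  (exists g, [/\ J g, g != 0 & g \is nu.-homog]) /\
  (forall j g, J g -> g != 0 -> g \is j.-homog -> (nu <= j)%N).

(* The total degree; [msize] is one more than it for a nonzero polynomial. *)
Definition mpdeg (g : S) : nat := (msize g).-1.

(* The points of Proj S, as homogeneous prime ideals. They are boolean
   predicates, as in ring_quotient; under the classical axioms loaded above this
   loses no prime ideal. *)
Definition proj_point (P : {pred S}) : Prop :=
  [/\ idealr_closed P, prime_idealr_closed P,
      (forall g e, g \in P -> pihomog mdeg e g \in P)
    & exists i : 'I_N, 'X_i \notin P].

(* A chain of length r of points of V(J) in Proj S, each one a strict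
   specialization of the previous one. *)
Definition proj_chain (J : S -> Prop) (r : nat) (P : nat -> {pred S}) : Prop :=
  (forall i, (i <= r)%N ->
     proj_point (P i) /\ (forall g, J g -> g \in P i)) /\
  (forall i, (i < r)%N ->
     {subset P i <= P i.+1} /\ exists g, g \in P i.+1 /\ g \notin P i).

(* dim Proj (S / J) = r (Krull dimension). *)
Definition proj_dim (J : S -> Prop) (r : nat) : Prop :=
  (exists P, proj_chain J r P) /\ ~ (exists P, proj_chain J r.+1 P).

End Graded.

Section ProjectiveSpace.
Variables (k : fieldType) (n : nat).

Definition normalized (p : 'rV[k]_n.+1) : bool :=
  [exists i, (p 0 i == 1) && [forall j : 'I_n.+1, (j < i)%N ==> (p 0 j == 0)]].

(* The k-rational points of P^n, each given by its unique vector of homogeneous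
   coordinates whose first nonzero coordinate is 1. For k algebraically closed
   these are all the closed points. *)
Definition pspace := {p : 'rV[k]_n.+1 | normalized p}.

Definition coord (y : pspace) (i : 'I_n.+1) : k := sval y 0 i.

Definition pivot (y : pspace) : 'I_n.+1 :=
  odflt ord0 [pick i | coord y i == 1].

End ProjectiveSpace.

Section RationalMap.
Variables (k : fieldType) (m n : nat).
Local Notation R := {mpoly k[m.+1]}.
Local Notation B := {mpoly k[n.+1]}.
Variable f : 'I_n.+1 -> R.

(* The ideal of the (affine cone over the) closed image of the map: all
   polynomials vanishing on (f_0(x), ..., f_n(x)) for x outside V(I). *)
Definition closed_image_ideal (G : B) : Prop :=
  forall x : 'I_m.+1 -> k,
    (exists i, (f i).@[x] != 0) -> G.@[fun i => (f i).@[x]] = 0.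

Definition generically_finite : Prop := proj_dim closed_image_ideal m.

(* The kernel of R[T_0, ..., T_n] -> R[t], T_i |-> f_i t, whose image is the
   Rees algebra R[It] = \bigoplus_s I^s t^s. *)
Definition rees_ideal (F : {mpoly R[n.+1]}) : Prop :=
  mmap (@polyC R) (fun i => f i *: 'X) F = 0.

(* The kernel of R -> Rees(I) \otimes_B k(y): the Rees equations specialized at
   T = y. They are bihomogeneous, so the choice of coordinates is immaterial. *)
Definition fiber_ideal (y : pspace k n) (g : R) : Prop :=
  exists F, rees_ideal F /\ g = F.@[fun i => (coord y i)%:MP].

Definition fiber_dim (y : pspace k n) (r : nat) : Prop :=
  proj_dim (fiber_ideal y) r.

(* Any i with y_i = 1 in place of the pivot gives the same ideal, so the same
   gcd up to a nonzero scalar. *)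
Definition hpoly (y : pspace k n) : R :=
  gcd_of (fun j => f j - coord y j *: f (pivot y)).

(* Y is the set of closed points of P^n whose fiber has dimension m - 1. *)
Definition is_Ym1 (Y : {fset (pspace k n)}) : Prop :=
  forall y, y \in Y <-> fiber_dim y m.-1.

End RationalMap.

(* Main.v *)
(* For a point y with pivot i, every f_j is congruent to y_j * f_i modulo h_y, so
   I^s lies in (f_i^s, h_y). Since gcd(f) = 1, this is a complete intersection of
   codimension 2 in a polynomial ring in at least 3 variables, hence saturated,
   and it contains every F in (I^s)^sat; when deg F < sd, only h_y can contribute,
   that is, h_y divides F. The h_y are pairwise coprime because distinct points
   have non-proportional coordinates, so their product divides F. Finally
   deg h_y > 0 for y in Y_(m-1) by a dimension count, and therefore the same
   bound shows that Y_(m-1) is finite. *)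
Require Import Defs.
From HB Require Import structures.
From mathcomp Require Import all_boot all_order all_algebra finmap mpoly.
From mathcomp Require Import ring_quotient zify ring.
From Stdlib Require Import Classical ClassicalEpsilon.
Set Implicit Arguments.
Unset Strict Implicit.
Unset Printing Implicit Defensive.
Import GRing.Theory.
Local Open Scope ring_scope.

(** * Factorial domains *)

(** Factoriality is what turns coprimality into algebra. Having no common prime divisor makes
    [f_i^s] regular modulo [h_y], lets coprime divisors multiply, and guarantees that the gcd
    defining [h_y] exists. Saturation then rests on the powers [X_i^e, X_j^e, X_l^e] of three
    distinct variables, whose Koszul syzygies are explicit; this is where [m >= 2] enters. The
    dimension of a fiber is known only through chains of homogeneous primes, so the count goes
    through transcendence degree: each strict step of a chain of primes contributes one
    algebraically independent element. The [m] primes of a fiber, completed by [0] and the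
    irrelevant ideal, give [m + 1] steps, which [m + 1] variables allow. A contradiction needs one
    further prime in the chain. *)

Section Factorial.
Variable D : idomainType.
Implicit Types a b c p q u x : D.

Definition prime_elt p : Prop :=
  [/\ p != 0, p \isn't a GRing.unit
    & forall a b, divides p (a * b) -> divides p a \/ divides p b].

Definition factorial_domain : Prop := forall x, x != 0 ->
  exists (u : D) (s : seq D),
    [/\ u \is a GRing.unit, forall p, p \in s -> prime_elt p
      & x = u * \prod_(p <- s) p].

Definition no_common_prime (I : Type) (F : I -> D) : Prop :=
  forall q, prime_elt q -> ~ (forall i, divides q (F i)).

Definition coprime_elt a b : Prop :=
  forall q, prime_elt q -> divides q a -> divides q b -> False.

Lemma divides_trans a b c : divides a b -> divides b c -> divides a c.
Proof. by move=> [r ->] [t ->]; exists (t * r); rewrite mulrA. Qed.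

Lemma divides_mull a b c : divides a b -> divides a (c * b).
Proof. by move=> [r ->]; exists (c * r); rewrite mulrA. Qed.

Lemma divides_mulr a b c : divides a b -> divides a (b * c).
Proof. by rewrite mulrC; apply: divides_mull. Qed.

Lemma dividesD a b c : divides a b -> divides a c -> divides a (b + c).
Proof. by move=> [r ->] [t ->]; exists (r + t); rewrite mulrDl. Qed.

Lemma dividesN a b : divides a b -> divides a (- b).
Proof. by move=> [r ->]; exists (- r); rewrite mulNr. Qed.

Lemma divides_mul2l c a b : c != 0 -> divides (c * a) (c * b) -> divides a b.
Proof.
move=> c0 [r]; rewrite mulrCA => /(mulfI c0) ->.
by exists r.
Qed.

Lemma divides_unit u a : u \is a GRing.unit -> divides u a.
Proof. by move=> uu; exists (a * u^-1); rewrite divrK. Qed.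

Lemma divides_unit_unit u a :
  u \is a GRing.unit -> divides a u -> a \is a GRing.unit.
Proof. by move=> uu [r eu]; move: uu; rewrite eu unitrM => /andP[]. Qed.

Lemma prime_elt_sym p q :
  prime_elt p -> prime_elt q -> divides q p -> divides p q.
Proof.
move=> [p0 pu pP] [q0 qu _] [w pE].
have /pP[[v wE]|//] : divides p (w * q) by rewrite -pE; exists 1; rewrite mul1r.
case/negP: qu; apply: (@divides_unit_unit 1); first exact: unitr1.
exists v; apply: (mulIf p0); rewrite mul1r.
by rewrite {1}pE wE -mulrA (mulrC p) mulrA.
Qed.

Lemma prime_elt_prod p (I : eqType) (s : seq I) (F : I -> D) : prime_elt p ->
  divides p (\prod_(i <- s) F i) -> exists2 i, i \in s & divides p (F i).
Proof.
move=> pp; elim: s => [|x s IH].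
  rewrite big_nil => /(divides_unit_unit (unitr1 _)).
  by case: pp => _ /negP.
rewrite big_cons; case: (pp) => _ _ pP /pP[px|/IH[i is_ pi]].
  by exists x => //; rewrite mem_head.
by exists i => //; rewrite in_cons is_ orbT.
Qed.

Lemma prime_elt_exp p a n : prime_elt p -> divides p (a ^+ n) -> divides p a.
Proof.
move=> pp; elim: n => [|n IH]; case: (pp) => _ pu pP.
  by rewrite expr0 => /(divides_unit_unit (unitr1 _)) /(negP pu).
by rewrite exprS => /pP[|/IH].
Qed.

Hypothesis fD : factorial_domain.

Lemma factorial_ind (P : D -> Prop) :
  (forall u, u \is a GRing.unit -> P u) ->
  (forall p x, prime_elt p -> x != 0 -> P x -> P (p * x)) ->
  forall x, x != 0 -> P x.
Proof.
move=> Pu Pp x x0; have [u [s [uu sp xE]]] := fD x0.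
move: sp x0; rewrite {x}xE; elim: s => [|p s IH] sp.
  by move=> _; rewrite big_nil mulr1; apply: Pu.
rewrite big_cons mulrCA => x0; apply: Pp.
- by apply: sp; rewrite mem_head.
- by apply: contra x0 => /eqP->; rewrite mulr0.
- apply: IH; first by move=> q qs; apply: sp; rewrite in_cons qs orbT.
  by apply: contra x0 => /eqP->; rewrite mulr0.
Qed.

Lemma exists_prime_divisor x : x != 0 -> x \isn't a GRing.unit ->
  exists2 p, prime_elt p & divides p x.
Proof.
move: x; apply: factorial_ind => [u -> //|p y pp _ _ _]; exists p => //.
by exists y; rewrite mulrC.
Qed.

(** Strips the primes of [a] one at a time: each divides [b * c] but not [b], hence divides [c] and
    can be cancelled. *)
Lemma coprime_elt_divides a b c :
  a != 0 -> coprime_elt a b -> divides a (b * c) -> divides a c.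
Proof.
move=> a0; move: a a0 b c.
apply: factorial_ind => [u uu b c _ _|p x pp x0 IH b c cop].
  exact: divides_unit.
have pn0 : p != 0 by case: pp.
move=> dv; have : divides p (b * c).
  by apply: divides_trans dv; exists x; rewrite mulrC.
case: (pp) => _ _ pP /pP[pb|[c' cE]].
  by case: (cop p pp) => //; exists x; rewrite mulrC.
move: dv; rewrite cE mulrA (mulrC _ p) => /(divides_mul2l pn0) dv.
have /IH/(_ dv) [w ->] : coprime_elt x b.
  by move=> q qp qx qb; apply: (cop q qp) => //; apply: divides_mull.
by exists w; rewrite -mulrA (mulrC x).
Qed.

Lemma coprime_elt_mul_divides a b x : a != 0 ->
  coprime_elt a b -> divides a x -> divides b x -> divides (a * b) x.
Proof.
move=> a0 cop dax [c xE]; have [|w cE] := @coprime_elt_divides a b c a0 cop.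
  by rewrite mulrC -xE.
by exists w; rewrite xE cE mulrA.
Qed.

Lemma coprime_prod_divides (I : eqType) (s : seq I) (F : I -> D) x :
  (forall i, i \in s -> F i != 0) ->
  (forall i j, i \in s -> j \in s -> i != j -> coprime_elt (F i) (F j)) ->
  uniq s -> (forall i, i \in s -> divides (F i) x) ->
  divides (\prod_(i <- s) F i) x.
Proof.
elim: s => [|i s IH] F0 cop /=; first by rewrite big_nil; exists x; rewrite mulr1.
case/andP=> is_ us dv; rewrite big_cons.
have sub j : j \in s -> j \in i :: s by move=> js; rewrite in_cons js orbT.
apply: coprime_elt_mul_divides.
- by apply: F0; rewrite mem_head.
- move=> q qp qi /(prime_elt_prod qp)[j js qj].
  apply: (cop i j _ _ _ q) => //; rewrite ?mem_head ?sub //.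
  by apply: contraNneq is_ => ->.
- by apply: dv; rewrite mem_head.
apply: IH => //; first by move=> j /sub/F0.
- by move=> j l /sub js /sub; apply: cop.
- by move=> j /sub/dv.
Qed.

Lemma exists_gcd_decomposition (I : Type) (F : I -> D) i0 : F i0 != 0 ->
  exists h G, (forall i, F i = h * G i) /\ no_common_prime G.
Proof.
(* [x] collects the prime factors of [F i0] still to be examined, and [y] those already known not to
   divide the whole family. A prime of [x] either moves into the common factor or joins [y]. The
   start is [x = F i0], [y = 1]. *)
pose P x := forall (F : I -> D) y, F i0 = x * y -> F i0 != 0 ->
  (forall q, prime_elt q -> divides q y -> ~ (forall i, divides q (F i))) ->
  exists h G, (forall i, F i = h * G i) /\ no_common_prime G.
suff H : forall x, x != 0 -> P x.
  move=> F0; apply: (H _ F0 F 1) => //; first by rewrite mulr1.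
  by move=> q [_ /negP qu _] /(divides_unit_unit (unitr1 _)).
apply: factorial_ind => [u uu|p x pp x0 IH] {}F y FE F0 yP.
  exists 1, F; split=> [i|q qp qF]; first by rewrite mul1r.
  apply: (yP q qp) => //; have [w wE] := qF i0.
  by exists (u^-1 * w); rewrite -mulrA -wE FE mulKr.
have pn0 : p != 0 by case: pp.
have [pF|npF] := classic (forall i, divides p (F i)); last first.
  apply: (IH F (p * y)) => //; first by rewrite FE mulrCA mulrA.
  move=> q qp; case: (qp) => _ _ qP /qP[qdp|qy] qF; last exact: (yP q).
  by apply: npF => i; apply: divides_trans (qF i); apply: prime_elt_sym.
pose F' i := epsilon (inhabits 0) (fun r => F i = r * p).
have F'E i : F i = p * F' i.
  by rewrite mulrC /F'; apply: epsilon_spec (pF i).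
have [||q qp qy qF'|h [G [hE Gp]]] := IH F' y.
- by apply: (mulfI pn0); rewrite -F'E FE mulrA.
- by apply: contra F0 => /eqP F'0; rewrite F'E F'0 mulr0.
- by apply: (yP q qp qy) => i; rewrite F'E; apply: divides_mull.
exists (p * h), G; split=> // i.
by rewrite F'E hE mulrA.
Qed.

(** This makes the factor [h] of [exists_gcd_decomposition] a greatest common divisor: a prime of
    [e] not dividing [h] would divide every [G i]. *)
Lemma divides_no_common_prime (I : Type) (G : I -> D) h e : e != 0 ->
  no_common_prime G -> (forall i, divides e (h * G i)) -> divides e h.
Proof.
move=> e0 Gp; move: e e0 h.
apply: factorial_ind => [u uu h _|p e pp e0 IH h dv].
  exact: divides_unit.
have pn0 : p != 0 by case: pp.
have [[h' hE]|nph] := classic (divides p h).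
  have [|w wE] := IH h'.
    move=> i; apply: (divides_mul2l pn0).
    by rewrite mulrA (mulrC p h') -hE.
  by exists w; rewrite hE wE -mulrA (mulrC e).
case: (Gp p pp) => i; case: (pp) => _ _ pP.
have /pP[//|//] : divides p (h * G i).
by apply: divides_trans (dv i); exists e; rewrite mulrC.
Qed.

Lemma gcd_ofP (I : Type) (F : I -> D) i0 : F i0 != 0 -> is_gcd F (gcd_of F).
Proof.
move=> F0; rewrite /gcd_of; apply: epsilon_spec.
have [h [G [FE Gp]]] := exists_gcd_decomposition F0.
exists h; split=> [i|e eF]; first by rewrite FE; exists (G i); rewrite mulrC.
apply: (divides_no_common_prime _ Gp) => [|i]; last by rewrite -FE.
by apply: contra F0 => /eqP e0; have [w ->] := eF i0; rewrite e0 mulr0.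
Qed.

End Factorial.

(** * Gauss's lemma *)

Definition irreducible_elt (D : idomainType) (x : D) : Prop :=
  [/\ x != 0, x \isn't a GRing.unit
    & forall a b, x = a * b -> a \is a GRing.unit \/ b \is a GRing.unit].

Section Gauss.
Variable D : idomainType.
Hypothesis fD : factorial_domain D.
Implicit Types (c : D) (f g p r : {poly D}).

Lemma factorial_irreducible_prime (x : D) : irreducible_elt x -> prime_elt x.
Proof.
move=> [x0 xu xI]; have [p pp [w wE]] := exists_prime_divisor fD x0 xu.
case: (xI _ _ wE) => [wu|pu]; last by case: pp => _ /negP.
have [p0 pun pP] := pp; split=> // a b [r rE].
have dvx z : divides p z -> divides x z.
  by move=> [t ->]; exists (t * w^-1); rewrite wE mulrA divrK.
have /pP[] : divides p (a * b) by exists (r * w); rewrite rE wE mulrA.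
  by move/dvx; left.
by move/dvx; right.
Qed.

Lemma dividesZ c f : divides c%:P f <-> exists g, f = c *: g.
Proof.
by split=> [[g ->]|[g ->]]; exists g; rewrite -mul_polyC mulrC.
Qed.

Lemma divides_polyC c (a : D) : divides c a -> divides c%:P a%:P.
Proof. by move=> [r ->]; exists r%:P; rewrite polyCM. Qed.

(* Induction on the sizes, by stripping a leading term divisible by c. *)
Lemma prime_elt_polyC c : prime_elt c -> prime_elt (c%:P : {poly D}).
Proof.
move=> [c0 cu cP]; split; first by rewrite polyC_eq0.
  by rewrite poly_unitE coefC eqxx /= (negbTE cu) andbF.
move=> f g; have [n] := ubnP (size f + size g).
elim: n f g => // n IH f g; rewrite ltnS => sz cfg.
have [->|f0] := eqVneq f 0; first by left; exists 0; rewrite mul0r.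
have [->|g0] := eqVneq g 0; first by right; exists 0; rewrite mul0r.
have dvlead h : divides c (lead_coef h) ->
    divides c%:P (lead_coef h *: 'X^((size h).-1)).
  by move=> ch; rewrite -mul_polyC; apply/divides_mulr/divides_polyC.
have drop (h : {poly D}) : h != 0 ->
    (size (h - lead_coef h *: 'X^((size h).-1))%R < size h)%N.
  move=> h0; rewrite (polySpred h0) ltnS.
  apply/leq_sizeP => j; rewrite leq_eqVlt => /predU1P[<-|lt].
    by rewrite coefB coefZ coefXn eqxx mulr1 subrr.
  rewrite coefB coefZ coefXn (gtn_eqF lt) mulr0 subr0.
  by apply/leq_sizeP: lt; rewrite -polySpred.
have back h : divides c (lead_coef h) ->
    divides c%:P (h - lead_coef h *: 'X^((size h).-1)) -> divides c%:P h.
  move=> /dvlead dl dh; rewrite -[h](subrK (lead_coef h *: 'X^((size h).-1))).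
  exact: dividesD.
have : divides c (lead_coef f * lead_coef g).
  rewrite -lead_coefM; move/dividesZ: cfg => [w ->].
  by rewrite lead_coefZ mulrC; exists (lead_coef w).
case/cP=> cl.
- have [] := IH (f - lead_coef f *: 'X^((size f).-1)) g.
  + by apply: leq_trans sz; rewrite ltn_add2r drop.
  + rewrite mulrBl; apply: dividesD => //; apply/dividesN/divides_mulr.
    exact: dvlead.
  + by move/(back f cl); left.
  + by right.
- have [] := IH f (g - lead_coef g *: 'X^((size g).-1)).
  + by apply: leq_trans sz; rewrite ltn_add2l drop.
  + rewrite mulrBr; apply: dividesD => //; apply/dividesN/divides_mull.
    exact: dvlead.
  + by left.
  + by move/(back g cl); right.
Qed.

(** Each prime of [c] divides [r * p] but not the primitive [p]; being prime in [{poly D}] as well,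
    it divides [r] and cancels. *)
Lemma Gauss_cancel c p g r : c != 0 ->
  (forall q, prime_elt q -> ~ divides q%:P p) ->
  c *: g = r * p -> divides p g.
Proof.
move=> c0 prim; move: c c0 r.
apply: (factorial_ind fD) => [u uu|q c qp c0 IH] r.
  move=> e; exists (u^-1 *: r).
  by rewrite -scalerAl -e scalerA mulVr // scale1r.
rewrite -scalerA => e.
have q0 : q != 0 by case: qp.
have : divides q%:P (r * p) by apply/dividesZ; exists (c *: g).
have [_ _ qP] := prime_elt_polyC qp; case/qP => [/dividesZ[r1 r1E]|/prim //].
apply: (IH r1); apply: (mulfI (x := q%:P)); first by rewrite polyC_eq0.
by rewrite mul_polyC e r1E mulrA mul_polyC.
Qed.

(** The primes of [c] are distributed between [g] and [r]. Only constants are removed, so the degree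
    of [g] survives; this is how a nonconstant gcd later yields a non-unit factor of [p]. *)
Lemma Gauss_factor c p g r : c != 0 -> c *: p = g * r ->
  exists g1 r1 a, [/\ p = g1 * r1, a != 0, size g1 = size g & g = a *: g1].
Proof.
move=> c0; move: c c0 g r.
apply: (factorial_ind fD) => [u uu|q c qp c0 IH] g r.
  move=> e; exists g, (u^-1 *: r), 1; split; rewrite ?oner_eq0 ?scale1r //.
  by rewrite -scalerAr -e scalerA mulVr // scale1r.
rewrite -scalerA => e.
have q0 : q != 0 by case: qp.
have qP0 : q%:P != 0 :> {poly D} by rewrite polyC_eq0.
have : divides q%:P (g * r) by apply/dividesZ; exists (c *: p).
have [_ _ qP] := prime_elt_polyC qp; case/qP => /dividesZ[w wE].
  have [|g1 [r1 [a [pE a0 sg gE]]]] := IH w r.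
    by apply: (mulfI qP0); rewrite mulrA !mul_polyC e wE.
  exists g1, r1, (q * a); split; rewrite ?mulf_neq0 //.
    by rewrite wE size_scale.
  by rewrite wE gE scalerA.
apply: (IH g w); apply: (mulfI qP0).
by rewrite mulrCA !mul_polyC e wE.
Qed.

(* On {poly D}, %| is divisibility up to a nonzero constant, that is, over the
   fraction field of D; Gauss_cancel and Gauss_factor clear the denominators. *)
Lemma irreducible_prime_poly p : irreducible_elt p -> prime_elt p.
Proof.
move=> pI; have [p0 pu pirr] := pI.
have [sp|sp] := leqP (size p) 1.
  rewrite (size1_polyC sp); apply/prime_elt_polyC/factorial_irreducible_prime.
  split.
  - by move: p0; rewrite {1}(size1_polyC sp) polyC_eq0.
  - apply: contra pu; rewrite {2}(size1_polyC sp) poly_unitE size_polyC coefC /=.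
    move=> u0; rewrite u0 andbT.
    by have -> : p`_0 != 0 by apply: contraTneq u0 => ->; rewrite unitr0.
  - move=> a b ab; have [||] := pirr a%:P b%:P.
    + by rewrite -polyCM -ab -size1_polyC.
    + by rewrite poly_unitE coefC eqxx => /andP[_]; left.
    + by rewrite poly_unitE coefC eqxx => /andP[_]; right.
have unit_size (w : {poly D}) : w \is a GRing.unit -> size w = 1%N.
  by rewrite poly_unitE => /andP[/eqP].
have prim q : prime_elt q -> ~ divides q%:P p.
  move=> [q0 qu _] [w wE]; case: (pirr _ _ wE) => [/unit_size sw|].
    by move: sp; rewrite wE mulrC mul_polyC size_scale // sw.
  by rewrite poly_unitE coefC eqxx (negbTE qu) andbF.
split=> // f g [w fgE].
have [cop|ncop] := boolP (coprimep p f).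
  have : p %| f * g by rewrite fgE dvdp_mull.
  rewrite Gauss_dvdpr // => /Pdiv.WeakIdomain.dvdpP[[c r] /= c0 e].
  by right; apply: (Gauss_cancel c0 prim e).
(* Here [h] is nonconstant, so irreducibility makes the complementary factor of [p] a unit. Thus [p]
   agrees with [h] up to constants and units, and divides [f] because [h] does. *)
left; set h := gcdp p f.
have h0 : h != 0 by rewrite gcdp_eq0 negb_and p0.
have /Pdiv.WeakIdomain.dvdpP[[c r] /= c0 e] : h %| p by apply: dvdp_gcdl.
rewrite mulrC in e.
have [g1 [r1 [a [pE a0 sg hE]]]] := Gauss_factor c0 e.
have r1u : r1 \is a GRing.unit.
  case: (pirr _ _ pE) => // /unit_size s1.
  by move: ncop; rewrite coprimep_def -/h -sg s1.
have /Pdiv.WeakIdomain.dvdpP[[c' r'] /= c'0 e'] : h %| f by apply: dvdp_gcdr.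
apply: (@Gauss_cancel c' p f (a *: r' * r1^-1)) => //.
by rewrite e' hE pE (mulrC g1) mulrA divrK // -scalerAl -scalerAr.
Qed.

End Gauss.

(** * Multivariate polynomials as univariate polynomials in the last variable *)

Lemma mpoly_rmorph_ext (R : comNzRingType) n (S : nzRingType)
    (phi psi : {rmorphism {mpoly R[n]} -> S}) :
  (forall c, phi c%:MP = psi c%:MP) -> (forall i, phi 'X_i = psi 'X_i) ->
  phi =1 psi.
Proof.
move=> eqC eqX p; rewrite [p]mpolyE !rmorph_sum; apply: eq_bigr => m _.
rewrite -mul_mpolyC !rmorphM eqC mpolyXE_id !rmorph_prod; congr (_ * _).
by apply: eq_bigr => i _; rewrite !rmorphXn eqX.
Qed.

Section MUni.
Variables (R : comNzRingType) (n : nat).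
Local Notation widen := (widen_ord (leqnSn n)).

Lemma muniXU_max : muni 'X_ord_max = 'X :> {poly {mpoly R[n]}}.
Proof.
rewrite muniE msuppX big_seq1 mcoeffX eqxx scale1r mnm1E eqxx expr1.
rewrite (_ : [multinom _ | i < n] = 0%MM) ?mpolyX0 ?scale1r //.
apply/mnmP => i; rewrite mnmE mnm0E mnm1E; apply/eqP; rewrite eqb0.
by rewrite -val_eqE /= gtn_eqF.
Qed.

Lemma muniXU_widen i : muni 'X_(widen i) = ('X_i)%:P :> {poly {mpoly R[n]}}.
Proof.
rewrite muniE msuppX big_seq1 mcoeffX eqxx scale1r mnm1E.
rewrite -val_eqE /= ltn_eqF // expr0 alg_polyC; congr (_%:P); congr 'X_[_].
by apply/mnmP => j; rewrite mnmE !mnm1E -!val_eqE.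
Qed.

Lemma ord_widenP (i : 'I_n.+1) : i = ord_max \/ exists j, i = widen j.
Proof.
have [e|ne] := eqVneq i ord_max; [by left | right].
have lt : (i < n)%N.
  by rewrite ltn_neqAle -ltnS ltn_ord andbT; move: ne; rewrite -val_eqE.
by exists (Ordinal lt); apply: val_inj.
Qed.

(** The inverse of [muni]. As a composite of ring morphisms it can be compared with [muni] on
    constants and variables alone. *)
Definition poly_mpoly : {poly {mpoly R[n]}} -> {mpoly R[n.+1]} :=
  horner_eval 'X_ord_max \o map_poly (@mwiden n R).

HB.instance Definition _ := GRing.RMorphism.on poly_mpoly.

Lemma muniK : cancel (@muni n R) poly_mpoly.
Proof.
apply: (@mpoly_rmorph_ext _ _ _ (poly_mpoly \o @muni n R) idfun) => [c|i] /=.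
  by rewrite muniC /poly_mpoly /= map_polyC /= /horner_eval hornerC mwidenC.
have [->|[j ->]] := ord_widenP i.
  by rewrite muniXU_max /poly_mpoly /= map_polyX /horner_eval hornerX.
rewrite muniXU_widen /poly_mpoly /= map_polyC /horner_eval hornerC /=.
by rewrite mwidenX mnmwiden1.
Qed.

Lemma poly_mpolyK : cancel poly_mpoly (@muni n R).
Proof.
have wK (c : {mpoly R[n]}) : muni (mwiden c) = c%:P.
  move: c; apply: (@mpoly_rmorph_ext _ _ _
    (@muni n R \o @mwiden n R) (@polyC {mpoly R[n]})) => [c|i] /=.
    by rewrite mwidenC muniC.
  by rewrite mwidenX mnmwiden1 muniXU_widen.
elim/poly_ind => [|q c IH]; first by rewrite !rmorph0.
rewrite rmorphD rmorphM /= muniD muniM IH; congr (_ * _ + _).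
  by rewrite /poly_mpoly /= map_polyX /horner_eval hornerX muniXU_max.
by rewrite /poly_mpoly /= map_polyC /horner_eval hornerC wK.
Qed.

End MUni.

(** * Factoriality of polynomial rings over a field *)

Section MPolyFactorial.
Variable k : fieldType.

Lemma mpoly_unitE n (p : {mpoly k[n]}) :
  (p \is a GRing.unit) = (msize p == 1%N).
Proof.
apply/idP/idP => [/andP[/eqP pE u]|/msize_poly1P[c c0 ->]].
  by rewrite pE msizeC -unitfE u.
by apply/andP; rewrite mpolyCK unitfE.
Qed.

(** Non-units have positive degree, so proper factors have smaller degree. That the irreducible
    factors are prime is a separate matter, settled by Gauss's lemma. *)
Lemma mpoly_irreducible_factorization n (x : {mpoly k[n]}) : x != 0 ->
  exists (u : {mpoly k[n]}) s, [/\ u \is a GRing.unit,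
    forall p, p \in s -> irreducible_elt p & x = u * \prod_(p <- s) p].
Proof.
have [N] := ubnP (msize x); elim: N x => // N IH x; rewrite ltnS => sx x0.
have [xu|xnu] := boolP (x \is a GRing.unit).
  by exists x, [::]; rewrite big_nil mulr1.
have [xI|xnI] := classic (irreducible_elt x).
  exists 1, [:: x]; split; rewrite ?unitr1 ?big_seq1 ?mul1r // => p.
  by rewrite inE => /eqP->.
have [a [b [xE au bu]]] : exists a b,
    [/\ x = a * b, a \isn't a GRing.unit & b \isn't a GRing.unit].
  apply: NNPP => nex; apply: xnI; split=> // a b xE.
  have [|au] := boolP (a \is a GRing.unit); first by left.
  have [|bu] := boolP (b \is a GRing.unit); first by right.
  by case: nex; exists a, b.
have a0 : a != 0 by apply: contraNneq x0 => a0; rewrite xE a0 mul0r.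
have b0 : b != 0 by apply: contraNneq x0 => b0; rewrite xE b0 mulr0.
have size_gt1 (c : {mpoly k[n]}) :
    c != 0 -> c \isn't a GRing.unit -> (1 < msize c)%N.
  by rewrite mpoly_unitE -msize_poly_eq0; case: (msize c) => [|[]].
have sa := size_gt1 a a0 au; have sb := size_gt1 b b0 bu.
have sxE : msize x = (msize a + msize b).-1 by rewrite xE msizeM.
have [|u [s [uu sI aE]]] := IH a _ a0.
  lia.
have [|v [t [vu tI bE]]] := IH b _ b0.
  lia.
exists (u * v), (s ++ t); split; first by rewrite unitrM uu.
  by move=> p; rewrite mem_cat => /orP[/sI|/tI].
by rewrite big_cat /= xE aE bE mulrACA.
Qed.

Lemma muni_unit n (p : {mpoly k[n.+1]}) :
  (muni p \is a GRing.unit) = (p \is a GRing.unit).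
Proof.
apply/idP/idP => /unitrPr[q pq1]; apply/unitrPr.
  by exists (poly_mpoly q); rewrite -[p]muniK -rmorphM pq1 rmorph1.
by exists (muni q); rewrite -muniM pq1 muni1.
Qed.

(** Induction on the number of variables: [muni] carries irreducibles to irreducibles over a
    factorial ring, where they are prime. With no variables, every nonzero element is a unit. *)
Lemma mpoly_factorial n : factorial_domain {mpoly k[n]}.
Proof.
elim: n => [|n IH] x x0.
  exists x, [::]; rewrite big_nil mulr1; split=> //.
  apply/andP; split; first by rewrite -nvar0_mpolyC.
  by rewrite unitfE -(@mpolyC_eq0 0) -nvar0_mpolyC.
have [u [s [uu sI xE]]] := mpoly_irreducible_factorization x0.
exists u, s; split=> // p /sI[p0 pu pI].
have inj0 (q : {mpoly k[n.+1]}) : (muni q == 0) = (q == 0).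
  by rewrite -(inj_eq (can_inj (@muniK k n))) rmorph0.
have [_ _ pP] : prime_elt (muni p).
  apply: (irreducible_prime_poly IH); split.
  - by rewrite inj0.
  - by rewrite muni_unit.
  - move=> a b pab.
    have /pI : p = poly_mpoly a * poly_mpoly b by rewrite -rmorphM -pab /= muniK.
    by rewrite -!muni_unit !poly_mpolyK.
have back (a : {mpoly k[n.+1]}) : divides (muni p) (muni a) -> divides p a.
  move=> [r rE]; exists (poly_mpoly r).
  by rewrite -[LHS]muniK rE rmorphM /= muniK.
split=> // a b [r rE].
have rE' : muni a * muni b = muni r * muni p.
  exact: etrans (esym (muniM a b)) (etrans (congr1 _ rE) (muniM r p)).
have /pP[/back|/back] : divides (muni p) (muni a * muni b).
- by exists (muni r).
- by left.
- by right.
Qed.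

End MPolyFactorial.

(** * Algebraic dependence and the dimension of polynomial rings *)

Section Dimension.
Variables (k : fieldType) (N : nat).
Local Notation S := {mpoly k[N]}.

Lemma msizeM_leS (p q : S) a b : (msize p <= a.+1)%N -> (msize q <= b.+1)%N ->
  (msize (p * q) <= (a + b).+1)%N.
Proof.
have [->|p0] := eqVneq p 0; first by rewrite mul0r msize0.
have [->|q0] := eqVneq q 0; first by rewrite mulr0 msize0.
rewrite msizeM // -subn1 => pa qb; apply: leq_trans (leq_sub2r 1 (leq_add pa qb)) _.
by rewrite addSn addnS subn1.
Qed.

Lemma msize_exp_leS (p : S) a n :
  (msize p <= a.+1)%N -> (msize (p ^+ n) <= (n * a).+1)%N.
Proof.
move=> pa; elim: n => [|n IH]; first by rewrite expr0 msize1.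
by rewrite exprS mulSn; apply: msizeM_leS.
Qed.

Lemma msize_prod_leS (I : Type) (s : seq I) (F : I -> S) (a : I -> nat) :
  (forall i, msize (F i) <= (a i).+1)%N ->
  (msize (\prod_(i <- s) F i) <= (\sum_(i <- s) a i).+1)%N.
Proof.
move=> Fa; elim/big_ind2: _ => [|p m q n|//]; first by rewrite msize1.
exact: msizeM_leS.
Qed.

Lemma card_bmultinom_le E : (#|{: 'X_{1..N < E.+1}}| <= E.+1 ^ N)%N.
Proof.
pose g (t : 'X_{1..N < E.+1}) : {ffun 'I_N -> 'I_E.+1} :=
  [ffun i => inord (bmnm t i)].
have g_inj : injective g.
  move=> s t /ffunP st; apply/val_inj/mnmP => i.
  have bd (r : 'X_{1..N < E.+1}) : (bmnm r i < E.+1)%N.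
    apply: leq_ltn_trans (bmdeg r).
    by rewrite mdegE (bigD1 i) //= leq_addr.
  by have /(congr1 val) := st i; rewrite !ffunE /= !inordK.
by have := leq_card g g_inj; rewrite card_ffun !card_ord.
Qed.

(* The D^(N+1) monomials in the x_i with exponents below D have degree O(D), so
   they live in a space of dimension O(D^N) and are linearly dependent. *)
Lemma mpoly_algebraic_dependence (x : 'I_N.+1 -> S) :
  exists2 Q : {mpoly k[N.+1]}, Q != 0 & mmap (@mpolyC N k) x Q = 0.
Proof.
pose e := (\max_i msize (x i))%N.
(* [E] bounds the degree of a product of the [x i] with exponents below [D]. Since [E + 1 <= D * C],
   there are at most [D^N * C^N] monomials of degree at most [E], and [C^N < D] makes this less than
   [D^(N+1)]. *)
pose C := (N.+1 * e).+1; pose D := (C ^ N).+1; pose E := (N.+1 * (D * e))%N.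
pose M := {ffun 'I_N.+1 -> 'I_D}; pose T : finType := 'X_{1..N < E.+1}.
pose mon (a : M) : 'X_{1..N.+1} := [multinom (a i : nat) | i < N.+1].
have mon_inj : injective mon.
  move=> a b /mnmP ab; apply/ffunP => i; apply: val_inj.
  by have := ab i; rewrite !mnmE.
pose y a := mmap1 x (mon a).
have ysize a : (msize (y a) <= E.+1)%N.
  have -> : E = (\sum_(i < N.+1) D * e)%N by rewrite sum_nat_const card_ord.
  apply: msize_prod_leS => i; rewrite mnmE.
  apply: leq_trans (_ : (a i * e).+1 <= _)%N.
    apply: msize_exp_leS; apply: leq_trans (leqnSn _).
    exact: (leq_bigmax (F := fun i => msize (x i))).
  by rewrite ltnS leq_mul2r (ltnW (ltn_ord _)) orbT.
have card_lt : (#|T| < #|{: M}|)%N.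
  apply: leq_ltn_trans (card_bmultinom_le E) _.
  rewrite card_ffun !card_ord.
  apply: (@leq_ltn_trans ((D * C) ^ N)%N).
    have [->|N0] := posnP N; first by rewrite !expn0.
    by rewrite leq_exp2r // /E /C mulnS mulnCA -add1n leq_add2r.
  by rewrite expnMn expnSr ltn_pmul2l ?expn_gt0.
pose A := \matrix_(i < #|{: M}|, j < #|T|) (y (enum_val i))@_(bmnm (enum_val j)).
have : kermx A != 0.
  rewrite -mxrank_eq0 mxrank_ker subn_eq0 -ltnNge.
  exact: leq_ltn_trans (rank_leq_col A) card_lt.
case/rowV0Pn => v /sub_kermxP vA v0.
pose Q := \sum_(a : M) v 0 (enum_rank a) *: 'X_[k, mon a].
have Qmon a : Q@_(mon a) = v 0 (enum_rank a).
  rewrite /Q raddf_sum (bigD1 a) //= mcoeffZ mcoeffX eqxx mulr1 big1 ?addr0 //.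
  by move=> b ba; rewrite mcoeffZ mcoeffX (inj_eq mon_inj) (negbTE ba) mulr0.
exists Q.
  apply: contra v0 => /eqP Q0; apply/eqP/rowP => j.
  by rewrite mxE -(enum_valK j) -Qmon Q0 mcoeff0.
have -> : mmap (@mpolyC N k) x Q = \sum_a v 0 (enum_rank a) *: y a.
  rewrite /Q (big_morph _ (mmapD _ _) (mmap0 _ _)); apply: eq_bigr => a _.
  by rewrite mmapZ mmapX mul_mpolyC.
apply/mpolyP => t; rewrite mcoeff0 raddf_sum /=.
under eq_bigr => a _ do rewrite mcoeffZ.
have [tE|tE] := ltnP (mdeg t) E.+1; last first.
  apply: big1 => a _; rewrite memN_msupp_eq0 ?mulr0 //.
  by apply: msize_mdeg_ge; apply: leq_trans tE.
pose t' : T := BMultinom tE.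
have := congr1 (fun B : 'rV_ _ => B 0 (enum_rank t')) vA.
rewrite !mxE => {2}<-.
rewrite (reindex (@enum_val M predT)); last by apply: onW_bij; apply: enum_val_bij.
by apply: eq_bigr => i _; rewrite enum_valK mxE enum_rankK.
Qed.

(* Reading Q in its last variable, q(x) * x_n + c(x) in J_(n+1) with x_n in J_n
   gives c(x) in J_n, hence c = 0, and then regularity of x_n gives q(x) in
   J_(n+1). *)
Lemma regular_chain_independent (J : nat -> S -> Prop) (x : nat -> S) :
  forall n,
  (forall i u v, (i <= n)%N -> J i u -> J i v -> J i (u - v)) ->
  (forall i u v, (i <= n)%N -> J i u -> J i (v * u)) ->
  (forall i u, (i < n)%N -> J i.+1 u -> J i u) ->
  (forall i, (i < n)%N -> J i (x i)) ->
  (forall i u, (i < n)%N -> J i.+1 (u * x i) -> J i.+1 u) ->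
  ~ J 0%N 1 ->
  forall Q : {mpoly k[n]}, J n (mmap (@mpolyC N k) (fun i => x i) Q) -> Q = 0.
Proof.
elim=> [|n IH] JB JM JS Jx Jr J1 Q.
  rewrite [Q]nvar0_mpolyC mmapC => JQ; apply/eqP; apply: contra_notT J1 => Q0.
  have c0 : Q@_0%MM != 0 by apply: contraNneq Q0 => ->; rewrite mpolyC0.
  by have := JM 0%N _ (Q@_0%MM)^-1%:MP isT JQ; rewrite -mpolyCM mulVf.
have {}IH := IH (fun i u v le => JB i u v (leqW le))
  (fun i u v le => JM i u v (leqW le)) (fun i u le => JS i u (leqW le))
  (fun i le => Jx i (leqW le)) (fun i u le => Jr i u (leqW le)) J1.
pose ev : {mpoly k[n]} -> S := mmap (@mpolyC N k) (fun i => x i).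
pose ev' : {poly {mpoly k[n]}} -> S := horner_eval (x n) \o map_poly ev.
have evE : mmap (@mpolyC N k) (fun i : 'I_n.+1 => x i) Q = ev' (muni Q).
  pose phi : {rmorphism {mpoly k[n.+1]} -> S} :=
    mmap (@mpolyC N k) (fun i : 'I_n.+1 => x i).
  apply: (@mpoly_rmorph_ext _ _ _ phi (ev' \o @muni n k)) => [c|i] /=.
    rewrite /phi /= mmapC muniC /ev' /= map_polyC /horner_eval hornerC.
    by rewrite /ev /= mmapC.
  rewrite /phi /= mmapX mmap1U.
  have [->|[j ->]] := ord_widenP i.
    by rewrite muniXU_max /ev' /= map_polyX /horner_eval hornerX.
  rewrite muniXU_widen /ev' /= map_polyC /horner_eval hornerC.
  by rewrite /ev /= mmapX mmap1U.
rewrite evE => JQ; apply: (can_inj (@muniK k n)); rewrite raddf0.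
move: (muni Q) JQ; elim/poly_ind => // q c IHq.
rewrite /ev' /= rmorphD rmorphM /= map_polyX map_polyC /horner_eval hornerMXaddC.
rewrite -/(horner_eval _ _) => JQ.
have Jc : J n (ev c).
  rewrite -[ev c](addKr (ev' q * x n)) addrC; apply: JB => //.
    exact: JS.
  by apply: JM => //; apply: Jx.
have c0 : c = 0 by apply: IH.
rewrite c0 addr0 IHq ?mul0r //; apply: Jr => //.
by move: JQ; rewrite c0 raddf0 addr0.
Qed.

End Dimension.

(** * Homogeneous polynomials *)

Section Homogeneous.
Import Order.Theory.
Variables (k : fieldType) (N : nat).
Implicit Types (p q h g u : {mpoly k[N]}).

(** Mirror image of the multiplicativity of leading terms: only the pair of smallest monomials
    reaches their sum. It controls the lowest degree occurring in a product. *)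
Lemma mlast_mul_neq0 p q :
  p != 0 -> q != 0 -> (p * q)@_(mlast p + mlast q) != 0.
Proof.
move=> p0 q0; rewrite mpolyME (bigD1_seq (mlast p, mlast q)) /=; first last.
- by rewrite allpairs_uniq // => -[? ?] [].
- by rewrite allpairs_f // mlast_supp.
rewrite mcoeffD mcoeffZ mcoeffX eqxx mulr1.
rewrite big_seq_cond raddf_sum /= big1 ?addr0.
  by rewrite mulf_neq0 // -mcoeff_msupp mlast_supp.
move=> _ /andP[/allpairsP[[m1 m2] /= [m1p m2q ->]] /= ne].
rewrite mcoeffZ mcoeffX; move/mlast_lemc: m1p; move/mlast_lemc: m2q.
rewrite le_eqVlt => /predU1P[m2E|lt le]; last first.
  by rewrite (gt_eqF (lemc_lt_add le lt)) mulr0.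
rewrite le_eqVlt => /predU1P[m1E|lt].
  by move: ne; rewrite -m1E -m2E eqxx.
by rewrite -m2E (gt_eqF (ltmc_le_add lt (lexx _))) mulr0.
Qed.

(** In [g = q * h] the degrees of the largest monomials of [q] and [h] add up to [d], and so do
    those of the smallest. A spread of degrees in [h] would force a negative spread in [q]. *)
Lemma dhomog_divisor h g d :
  g != 0 -> g \is d.-homog -> divides h g -> h \is (mpdeg h).-homog.
Proof.
move=> g0 gd [q gE].
have q0 : q != 0 by apply: contraNneq g0 => e; rewrite gE e mul0r.
have h0 : h != 0 by apply: contraNneq g0 => e; rewrite gE e mulr0.
have dE m : g@_m != 0 -> mdeg m = d.
  by rewrite -mcoeff_msupp; move/(dhomog_mf gd).
have dlead : (mdeg (mlead q) + mdeg (mlead h))%N = d.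
  rewrite -mdegD; apply: dE; rewrite gE mleadcM mulf_neq0 //.
    by rewrite mleadc_eq0.
  by rewrite mleadc_eq0.
have dlast : (mdeg (mlast q) + mdeg (mlast h))%N = d.
  by rewrite -mdegD; apply: dE; rewrite gE mlast_mul_neq0.
have lq : (mdeg (mlast q) <= mdeg (mlead q))%N.
  by apply/lemc_mdeg/mlast_lemc/mlead_supp.
have hlead : mpdeg h = mdeg (mlead h) by rewrite /mpdeg -mlead_deg.
apply/dhomogP => m mh; rewrite hlead.
have squeeze (a b A B c : nat) : (b <= B)%N -> (B + A)%N = d ->
    (b + a)%N = d -> (a <= c)%N -> (c <= A)%N -> c = A by lia.
apply: squeeze lq dlead dlast _ _; first exact: lemc_mdeg (mlast_lemc mh).
exact: lemc_mdeg (msupp_le_mlead mh).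
Qed.

Lemma mpdeg_dhomog p d : p != 0 -> p \is d.-homog -> mpdeg p = d.
Proof.
move=> p0 pd; rewrite /mpdeg -mlead_deg //=.
by apply: (dhomog_mf pd); apply: mlead_supp.
Qed.

Lemma mpdegM p q : p != 0 -> q != 0 -> mpdeg (p * q) = (mpdeg p + mpdeg q)%N.
Proof.
by move=> p0 q0; rewrite /mpdeg -!mlead_deg ?mulf_neq0 //= mleadM // mdegD.
Qed.

Lemma mpdeg_prod (I : eqType) (s : seq I) (F : I -> {mpoly k[N]}) :
  (forall i, i \in s -> F i != 0) ->
  mpdeg (\prod_(i <- s) F i) = (\sum_(i <- s) mpdeg (F i))%N.
Proof.
elim: s => [|i s IH] F0; first by rewrite !big_nil /mpdeg msize1.
have Fs j : j \in s -> F j != 0 by move=> js; apply: F0; rewrite inE js orbT.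
rewrite !big_cons mpdegM ?IH //; first by apply: F0; rewrite mem_head.
by rewrite prodf_seq_neq0; apply/allP => j /Fs.
Qed.

Lemma mpdeg_divides p q : q != 0 -> divides p q -> (mpdeg p <= mpdeg q)%N.
Proof.
move=> q0 [r qE]; have r0 : r != 0 by apply: contraNneq q0 => e; rewrite qE e mul0r.
have p0 : p != 0 by apply: contraNneq q0 => e; rewrite qE e mulr0.
by rewrite qE mpdegM // leq_addl.
Qed.

Lemma mpdeg_eq0_unit p : p != 0 -> mpdeg p = 0%N -> p \is a GRing.unit.
Proof.
rewrite mpoly_unitE /mpdeg -msize_poly_eq0.
by case: (msize p) => [|[]].
Qed.

Lemma dhomog_nonunit p d : (0 < d)%N -> p \is d.-homog -> p \isn't a GRing.unit.
Proof.
move=> d0 pd; apply/negP => pu.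
have p0 : p != 0 by apply: contraTneq pu => ->; rewrite unitr0.
move: pu d0; rewrite mpoly_unitE -(mpdeg_dhomog p0 pd) /mpdeg.
by move/eqP->.
Qed.

(** The cofactors in an identity [g = a * u + b * h] need not be homogeneous, so degrees are
    compared on components: the degree [e] part of [p * h] is [h] times the degree [e - t] part of
    [p]. *)
Lemma pihomog_mul_dhomog p h t e : h \is t.-homog ->
  divides h (pihomog mdeg e (p * h)) /\
  ((e < t)%N -> pihomog mdeg e (p * h) = 0).
Proof.
move=> ht; rewrite [p]mpolyE mulr_suml raddf_sum /=.
have mono m : pihomog mdeg e (p@_m *: 'X_[m] * h) =
    if (mdeg m + t)%N == e then p@_m *: 'X_[m] * h else 0.
  have mt : p@_m *: 'X_[m] * h \is (mdeg m + t).-homog.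
    by apply: dhomogM => //; apply: dhomogZ; rewrite dhomogX.
  case: eqP => [<-|/eqP ne]; first exact: pihomog_dE.
  exact: pihomog_ne0 ne mt.
split=> [|et].
  elim/big_ind: _ => [|x y|m _]; [by exists 0; rewrite mul0r|exact: dividesD|].
  rewrite mono; case: ifP => _; first by exists (p@_m *: 'X_[m]).
  by exists 0; rewrite mul0r.
by apply: big1 => m _; rewrite mono; case: eqP => //; lia.
Qed.

Lemma low_degree_divides u h g a b (e t r : nat) :
  (e < r)%N -> g \is e.-homog -> u \is r.-homog -> h \is t.-homog ->
  g = a * u + b * h -> divides h g.
Proof.
move=> er ge ur ht gE; rewrite -(pihomog_dE ge) gE raddfD /=.
have [_ /(_ er) ->] := pihomog_mul_dhomog a e ur.
by rewrite add0r; have [] := pihomog_mul_dhomog b e ht.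
Qed.

End Homogeneous.

(** * Saturation of a complete intersection of codimension two *)

(* Exactness of the Koszul complex of (x, y, z) turns the obstruction c into
   x * al + y * be, which corrects the coefficients of x * F to multiples of x. *)
Lemma koszul_saturation (D : idomainType) (x y z u h F : D) :
  x != 0 -> h != 0 ->
  (forall w, divides h (u * w) -> divides h w) ->
  (forall c a b, z * c = x * a + y * b -> exists al be, c = x * al + y * be) ->
  (forall a b, y * a = x * b -> exists c, a = x * c) ->
  (exists a b, x * F = a * u + b * h) ->
  (exists a b, y * F = a * u + b * h) ->
  (exists a b, z * F = a * u + b * h) ->
  exists a b, F = a * u + b * h.
Proof.
move=> x0 h0 cop colon reg [a0 [b0 e0]] [a1 [b1 e1]] [a2 [b2 e2]].
have syzygy s t a b a' b' :
    s * F = a * u + b * h -> t * F = a' * u + b' * h ->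
    u * (t * a - s * a') = (s * b' - t * b) * h.
  move=> es et; apply/eqP; rewrite -subr_eq0; apply/eqP.
  transitivity (t * (a * u + b * h) - s * (a' * u + b' * h)); first by ring.
  by rewrite -es -et; ring.
have E01 := syzygy _ _ _ _ _ _ e0 e1.
have [c01 c01E] : divides h (y * a0 - x * a1).
  by apply: cop; exists (x * b1 - y * b0).
have [c12 c12E] : divides h (z * a1 - y * a2).
  by apply: cop; exists (y * b2 - z * b1); apply: syzygy.
have [c20 c20E] : divides h (x * a2 - z * a0).
  by apply: cop; exists (z * b0 - x * b2); apply: syzygy.
have eb : x * b1 - y * b0 = c01 * u.
  by apply: (mulIf h0); rewrite -E01 c01E; ring.
(* The three minors satisfy [z(y a0 - x a1) + x(z a1 - y a2) + y(x a2 - z a0) = 0]; dividing by [h]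
   gives a relation among their quotients. *)
have ec : z * c01 = x * - c12 + y * - c20.
  apply: (mulIf h0); transitivity (z * (c01 * h)); first by ring.
  transitivity (- x * (c12 * h) - y * (c20 * h)); last by ring.
  by rewrite -c01E -c12E -c20E; ring.
have [al [be cE]] := colon _ _ _ ec.
(* Adding multiples of the trivial syzygy [(h, -u)] changes the cofactors of [x * F] and [y * F] but
   not these elements; with [al] and [be] the minors become zero, so regularity extracts the factor
   [x]. *)
have [|ga gaE] := reg (a0 - be * h) (a1 + al * h).
  apply/eqP; rewrite -subr_eq0; apply/eqP.
  transitivity ((y * a0 - x * a1) - (x * al + y * be) * h); first by ring.
  by rewrite c01E cE subrr.
have [|de deE] := reg (b0 + be * u) (b1 - al * u).
  apply/eqP; rewrite -subr_eq0; apply/eqP.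
  transitivity ((x * al + y * be) * u - (x * b1 - y * b0)); first by ring.
  by rewrite eb cE subrr.
have a0E : a0 = x * ga + be * h by rewrite -gaE subrK.
have b0E : b0 = x * de - be * u by rewrite -deE addrK.
by exists ga, de; apply: (mulfI x0); rewrite e0 a0E b0E; ring.
Qed.

Section Powers.
Variables (k : fieldType) (N : nat).
Implicit Types (p a b c : {mpoly k[N]}) (i j l : 'I_N).

Lemma mcoeff_Xexp_mul i e p (m : 'X_{1..N}) : (m i < e)%N -> ('X_i ^+ e * p)@_m = 0.
Proof.
move=> me; apply: memN_msupp_eq0; rewrite mpolyXn mulrC.
rewrite (perm_mem (msuppMX _ _)); apply/mapP => -[m' _ mE].
by move: me; rewrite mE mnmDE mulmnE mnm1E eqxx mul1n ltnNge leq_addr.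
Qed.

(** The remainder's support lies in that of [c], so a later division by a power of another variable
    preserves the bound on the exponent of ['X_i]. *)
Lemma Xexp_division i e c : exists c1 c0, c = 'X_i ^+ e * c1 + c0 /\
  forall m, c0@_m != 0 -> c@_m != 0 /\ (m i < e)%N.
Proof.
exists (\sum_(m <- msupp c | (e <= m i)%N) c@_m *: 'X_[m - U_(i) *+ e]).
exists (\sum_(m <- msupp c | ~~ (e <= m i)%N) c@_m *: 'X_[m]); split.
  rewrite {1}[c]mpolyE (bigID (fun m : 'X_{1..N} => (e <= m i)%N)) /=; congr (_ + _).
  rewrite mulr_sumr; apply: eq_bigr => m em.
  rewrite -scalerAr mpolyXn -mpolyXD addmC submK //.
  apply/mnm_lepP => j; rewrite mulmnE mnm1E; case: eqP => [<-|_].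
    by rewrite mul1n.
  by rewrite mul0n.
move=> m; rewrite raddf_sum /= => c0m; rewrite ltnNge.
suff [m' [m'c m'i /eqP <-]] : exists m',
    [/\ m' \in msupp c, ~~ (e <= m' i)%N & m' == m].
  by split=> //; rewrite -mcoeff_msupp.
apply: NNPP => nex; case/eqP: c0m; rewrite big_seq_cond; apply: big1.
move=> m' /andP[m'c m'i]; rewrite mcoeffZ mcoeffX.
by case: eqP => [e'|]; rewrite ?mulr0 //; case: nex; exists m'; rewrite e' eqxx -e'.
Qed.

(** Reduce [c] until its exponents in ['X_i] and ['X_l] are below [e]. Multiplying by ['X_j ^+ e]
    leaves these exponents alone, while every monomial on the right has one of them at least [e]; so
    the remainder is zero. The case [i = l] gives regularity modulo a single power. *)
Lemma Xexp_colon i l j e a b c : i != j -> l != j ->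
  'X_j ^+ e * c = 'X_i ^+ e * a + 'X_l ^+ e * b ->
  exists al be, c = 'X_i ^+ e * al + 'X_l ^+ e * be.
Proof.
move=> ij lj E; have [c1 [c0 [cE c0P]]] := Xexp_division i e c.
have [c2 [c3 [c0E c3P]]] := Xexp_division l e c0.
exists c1, c2; rewrite cE c0E addrA; apply/eqP; rewrite eq_sym addrC -subr_eq subrr.
apply/eqP/esym; apply/mpolyP => m; rewrite mcoeff0; apply/eqP/negPn/negP => cm.
have [/c0P[_ mi] ml] := c3P m cm.
case/negP: cm; apply/eqP.
rewrite -(mcoeffMX c3 (U_(j) *+ e)%MM m) -mpolyXn mulrC.
have -> : 'X_j ^+ e * c3 =
    'X_i ^+ e * (a - 'X_j ^+ e * c1) + 'X_l ^+ e * (b - 'X_j ^+ e * c2).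
  have c3E : c3 = c - 'X_i ^+ e * c1 - 'X_l ^+ e * c2.
    by rewrite cE c0E; ring.
  by rewrite {1}c3E !mulrBr E; ring.
have mE r : r != j -> (U_(j) *+ e + m)%MM r = m r.
  by move=> rj; rewrite mnmDE mulmnE mnm1E eq_sym (negbTE rj).
by rewrite mcoeffD !mcoeff_Xexp_mul ?addr0 ?mE.
Qed.

Lemma complete_intersection_saturated (i j l : 'I_N) (u h F : {mpoly k[N]}) e :
  i != j -> i != l -> j != l -> h != 0 -> coprime_elt h u ->
  (forall r, exists a b, 'X_r ^+ e * F = a * u + b * h) ->
  exists a b, F = a * u + b * h.
Proof.
move=> ij il jl h0 cop mem.
apply: (@koszul_saturation _ ('X_i ^+ e) ('X_j ^+ e) ('X_l ^+ e)) => //.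
- by rewrite expf_neq0 // -msupp_eq0 msuppX.
- by move=> w; apply: (coprime_elt_divides (mpoly_factorial (n := N))).
- by move=> c a b; apply: Xexp_colon.
move=> a b E; have [|al [be ->]] := @Xexp_colon i i j e b 0 a ij ij.
  by rewrite E mulr0 addr0.
by exists (al + be); rewrite mulrDr.
Qed.

End Powers.

(** * The fibers *)

Lemma ideal_gen_mem (R : comNzRingType) N (F : 'I_N -> R) i : ideal_gen F (F i).
Proof.
exists (fun j => (j == i)%:R); rewrite (bigD1 i) //= eqxx mul1r big1 ?addr0 //.
by move=> j /negbTE->; rewrite mul0r.
Qed.

Lemma ideal_exp_mem (R : comNzRingType) (J : R -> Prop) x e :
  J x -> ideal_exp J e (x ^+ e).
Proof.
move=> Jx; elim: e => [//|e IH]; exists [:: (x, x ^+ e)]; split.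
  by move=> ab; rewrite inE => /eqP->.
by rewrite big_seq1 exprS.
Qed.

Lemma ideal_exp1_mem (R : comNzRingType) (J : R -> Prop) x :
  J x -> ideal_exp J 1 x.
Proof. by rewrite -[X in _ -> _ X]expr1; apply: ideal_exp_mem. Qed.

Lemma ideal_exp_gen_decomp (R : comNzRingType) N (F : 'I_N -> R) u h s x :
  (forall i, exists a b, F i = a * u + b * h) -> ideal_exp (ideal_gen F) s x ->
  exists a b, x = a * u ^+ s + b * h.
Proof.
move=> Fuh; have gen z : ideal_gen F z -> exists a b, z = a * u + b * h.
  move=> [c ->]; elim/big_ind: _ => [|y z' [a [b ->]] [a' [b' ->]]|i _].
  - by exists 0, 0; ring.
  - by exists (a + a'), (b + b'); ring.
  - by have [a [b ->]] := Fuh i; exists (c i * a), (c i * b); ring.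
elim: s x => [|s IH] x; first by exists x, 0; rewrite expr0; ring.
move=> [l [lP ->]]; elim: l lP => [|[a b] l IHl] lP.
  by rewrite big_nil; exists 0, 0; ring.
have [|c [c' cE]] := IHl; first by move=> ab abl; apply: lP; rewrite inE abl orbT.
have [/gen[a1 [b1 /= ->]] /IH[a2 [b2 /= ->]]] := lP (a, b) (mem_head _ _).
rewrite big_cons cE /= exprS.
by exists (a1 * a2 + c), (a1 * b2 * u + b1 * (a2 * u ^+ s + b2 * h) + c'); ring.
Qed.

(** If no finite set captured [P], every list of elements satisfying [P] could be extended by a new
    one, up to length [B + 1]. *)
Lemma fset_of_bounded (T : choiceType) (P : T -> Prop) (B : nat) :
  (forall s : seq T, uniq s -> (forall x, x \in s -> P x) -> (size s <= B)%N) ->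
  exists Y : {fset T}, forall x, x \in Y <-> P x.
Proof.
move=> bounded; apply: NNPP => noY.
suff [s [us sP sz]] : exists s : seq T,
    [/\ uniq s, forall x, x \in s -> P x & size s = B.+1].
  by have := bounded s us sP; rewrite sz ltnn.
elim: B.+1 => [|N [s [us sP sz]]]; first by exists [::].
have [x Px xs] : exists2 x, P x & x \notin s.
  apply: NNPP => nex; apply: noY; exists [fset x in s]%fset => x.
  rewrite inE; split=> [/sP //|Px]; apply/negPn/negP => xs.
  by apply: nex; exists x.
exists (x :: s); split=> /=; rewrite ?xs ?sz //.
by move=> y; rewrite inE => /predU1P[->|/sP].
Qed.

Section Fiber.
Variables (k : fieldType) (m n d : nat) (f : 'I_n.+1 -> {mpoly k[m.+1]}).
Hypothesis d_gt0 : (0 < d)%N.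
Hypothesis fhomog : forall i, f i \is d.-homog.
Hypothesis fgcd : is_gcd f 1.
Implicit Types y : pspace k n.

Let S := {mpoly k[m.+1]}.
Let g y j : S := f j - Defs.coord y j *: f (pivot y).

Lemma normalizedP y : exists2 i, Defs.coord y i = 1 &
  forall j : 'I_n.+1, (j < i)%N -> Defs.coord y j = 0.
Proof.
have /existsP[i /andP[/eqP yi /forallP yj]] := svalP y.
by exists i => // j ji; have /implyP/(_ ji)/eqP := yj j.
Qed.

Lemma coord_pivot y : Defs.coord y (pivot y) = 1.
Proof.
rewrite /pivot; case: pickP => [i /eqP //|no].
by have [i yi _] := normalizedP y; have := no i; rewrite yi eqxx.
Qed.

(** The scalar is nonzero because [y] has a coordinate 1. Hence the first nonzero positions agree,
    and both coordinates there are 1. *)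
Lemma pspace_eq y z (c : k) :
  (forall j, Defs.coord y j = c * Defs.coord z j) -> y = z.
Proof.
move=> yz; have [i yi y0] := normalizedP y; have [j zj z0] := normalizedP z.
have c0 : c != 0.
  by apply: contra_eq_neq yi => c0; rewrite yz c0 mul0r eq_sym oner_eq0.
have ij : i = j.
  apply/val_inj/eqP; rewrite eqn_leq; apply/andP; split; rewrite leqNgt; apply/negP.
    by move=> /y0; rewrite yz zj mulr1 => /eqP; rewrite (negbTE c0).
  by move=> /z0 zi0; have /eqP := yi; rewrite yz zi0 mulr0 eq_sym oner_eq0.
have c1 : c = 1 by rewrite -yi yz ij zj mulr1.
by apply/val_inj/rowP => l; have := yz l; rewrite c1 mul1r.
Qed.

Lemma f_no_common_prime : no_common_prime f.
Proof.
move=> q qp qf; have [_ /(_ q qf)] := fgcd.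
by move/(divides_unit_unit (unitr1 _)); case: qp => _ /negP.
Qed.

Lemma fiber_gen_dhomog y j : g y j \is d.-homog.
Proof. by rewrite /g -scaleNr; apply: dhomogD; [|apply: dhomogZ]; apply: fhomog. Qed.

(** Otherwise [f (pivot y)], of positive degree [d], would divide every [f j] and hence their gcd
    1. *)
Lemma fiber_gen_neq0 y : exists j, g y j != 0.
Proof.
apply: NNPP => nex; have fE j : f j = Defs.coord y j *: f (pivot y).
  by apply/eqP; rewrite -subr_eq0; apply/negPn/negP => gj; apply: nex; exists j.
have [_ /(_ (f (pivot y)))] := fgcd; case=> [i|r r1].
  by rewrite (fE i) -mul_mpolyC; exists (Defs.coord y i)%:MP.
have /negP := dhomog_nonunit d_gt0 (fhomog (pivot y)); apply.
by apply: (@divides_unit_unit _ 1); [exact: unitr1 | exists r].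
Qed.

Lemma hpolyP y : is_gcd (g y) (hpoly f y).
Proof. by have [j] := fiber_gen_neq0 y; apply/gcd_ofP/mpoly_factorial. Qed.

Lemma hpoly_divides_gen y j : divides (hpoly f y) (g y j).
Proof. by have [] := hpolyP y. Qed.

Lemma hpoly_neq0 y : hpoly f y != 0.
Proof.
have [j] := fiber_gen_neq0 y; have [r ->] := hpoly_divides_gen y j.
by apply: contra_neq => ->; rewrite mulr0.
Qed.

Lemma hpoly_dhomog y : hpoly f y \is (mpdeg (hpoly f y)).-homog.
Proof.
have [j gj] := fiber_gen_neq0 y.
exact: dhomog_divisor gj (fiber_gen_dhomog y j) (hpoly_divides_gen y j).
Qed.

Lemma divides_hpoly_f y q j : divides q (hpoly f y) ->
  divides q (f (pivot y)) -> divides q (f j).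
Proof.
move=> qh qf; rewrite -[f j](subrK (Defs.coord y j *: f (pivot y))).
apply: dividesD; first exact: divides_trans (hpoly_divides_gen y j).
by rewrite -mul_mpolyC; apply: divides_mull.
Qed.

Lemma hpoly_coprime_pivot y : coprime_elt (hpoly f y) (f (pivot y)).
Proof.
move=> q qp qh qf; apply: (f_no_common_prime qp) => j.
exact: divides_hpoly_f qh qf.
Qed.

(** Modulo a common prime [q], the family [f] is proportional to both [y] and [z]. If some [y_j]
    differs from [y_(pivot z) * z_j], then [q] divides [f (pivot y)], against
    [hpoly_coprime_pivot]. *)
Lemma hpoly_coprime y z : y != z -> coprime_elt (hpoly f y) (hpoly f z).
Proof.
move=> yz q qp qy qz; case/eqP: yz.
apply: (@pspace_eq y z (Defs.coord y (pivot z))) => j.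
apply/eqP; rewrite -subr_eq0; apply/negPn/negP => c0.
have qg w l : divides q (hpoly f w) -> divides q (g w l).
  by move=> qw; apply: divides_trans (hpoly_divides_gen w l).
apply: (hpoly_coprime_pivot qp qy).
set c := _ - _ in c0.
have cE : c *: f (pivot y) =
    g z j + Defs.coord z j *: g y (pivot z) - g y j.
  rewrite /g /c -!mul_mpolyC mpolyCB mpolyCM.
  by ring.
rewrite -[f _](scalerK c0) cE -mul_mpolyC; apply: divides_mull.
rewrite -mul_mpolyC; apply: dividesD; last exact/dividesN/qg.
by apply: dividesD; [apply: qg | apply/divides_mull/qg].
Qed.

Lemma hpoly_divides_sat y s nu F : (2 <= m)%N ->
  sat (ideal_exp (ideal_gen f) s) F -> F \is nu.-homog -> (nu < s * d)%N ->
  divides (hpoly f y) F.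
Proof.
move=> m2 [e satF] Fnu lt; set u := f (pivot y) ^+ s.
pose i0 : 'I_m.+1 := inord 0; pose i1 : 'I_m.+1 := inord 1.
pose i2 : 'I_m.+1 := inord 2.
have [a [b FE]] : exists a b, F = a * u + b * hpoly f y.
  apply: (@complete_intersection_saturated _ _ i0 i1 i2 _ _ _ e).
  - by rewrite -val_eqE /= !inordK //; lia.
  - by rewrite -val_eqE /= !inordK //; lia.
  - by rewrite -val_eqE /= !inordK //; lia.
  - exact: hpoly_neq0.
  - by move=> q qp qh /(prime_elt_exp qp); apply: hpoly_coprime_pivot.
  move=> r; apply: (@ideal_exp_gen_decomp _ _ f) => [j|].
    have [w wE] := hpoly_divides_gen y j; exists (Defs.coord y j)%:MP, w.
    by rewrite -wE mul_mpolyC addrC subrK.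
  by apply: satF; apply: ideal_exp_mem; apply: ideal_gen_mem.
have ud : u \is (s * d).-homog by rewrite mulnC; apply: dhomogMn.
exact: low_degree_divides lt Fnu ud (hpoly_dhomog y) FE.
Qed.

Lemma fiber_ideal_gen y j : fiber_ideal f y (g y j).
Proof.
(* The Koszul relation between [f j] and [f (pivot y)], a Rees equation linear in [T]; at [T = y]
   the pivot coordinate is 1. *)
exists ((f j)%:MP * 'X_(pivot y) - (f (pivot y))%:MP * 'X_j); split.
  rewrite /rees_ideal mmapB !mul_mpolyC !mmapZ !mmapX !mmap1U !mul_polyC.
  by rewrite !scalerA mulrC subrr.
rewrite mevalB !mevalM !mevalC !mevalXU coord_pivot mulr1 /g -mul_mpolyC.
by rewrite (mulrC (Defs.coord y j)%:MP).
Qed.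

(* If h_y were constant, two coprime elements of P 0 would put a prime (q)
   strictly between 0 and P 0, and 0 < (q) < P 0 < ... < P (m-1) < (X_0..X_m)
   would be too long a chain. *)
Lemma mpdeg_hpoly_gt0 y : (1 <= m)%N -> fiber_dim f y m.-1 ->
  (0 < mpdeg (hpoly f y))%N.
Proof.
move=> m1 [[P [Ppt Pstrict]] _]; rewrite lt0n; apply/negP => /eqP deg0.
have hu : hpoly f y \is a GRing.unit.
  by apply: mpdeg_eq0_unit deg0; apply: hpoly_neq0.
have Pid i : (i < m)%N -> idealr_closed (P i).
  by move=> im; have [|[]] := Ppt i; first by lia.
have Pprime i a b : (i < m)%N -> a * b \in P i -> a \in P i \/ b \in P i.
  move=> im; have [|[_ prP _ _] _] := Ppt i; first by lia.
  by move=> /prP/orP.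
have PD i a b : (i < m)%N -> a \in P i -> b \in P i -> a - b \in P i.
  move=> im aP bP; have [_ _ /(_ (-1) b a bP aP)] := Pid i im.
  by rewrite mulN1r addrC.
have PM i a b : (i < m)%N -> b \in P i -> a * b \in P i.
  move=> im bP; have [P0i _ /(_ a b 0 bP P0i)] := Pid i im.
  by rewrite addr0.
(* A nonzero degree 0 component would be a unit of the homogeneous ideal [P i]. So the irrelevant
   ideal can top the chain. *)
have Pconst i a : (i < m)%N -> a \in P i -> a@_0%MM = 0.
  move=> im aP; have [|[idP _ homP _] _] := Ppt i; first by lia.
  have a0P := homP a 0%N aP; have [_ /negP P1 _] := idP.
  have aE : a@_0%MM = (pihomog mdeg 0 a)@_0%MM.
    rewrite {1}(pihomog_partitionE (leqnSn (msize a))) big_ord_recl mcoeffD.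
    set rest := \sum_(e < _) _; suff -> : rest@_0%MM = 0 by rewrite addr0.
    rewrite /rest (big_morph _ (mcoeffD _) (mcoeff0 _ _)); apply: big1 => e _.
    by apply: (@dhomog_nemf_coeff _ _ mdeg _ _ _ (pihomogP _ _ _)); rewrite /= mdeg0.
  rewrite aE; have [->|c0] := eqVneq (pihomog mdeg 0 a) 0; first exact: mcoeff0.
  case: P1; have cu : pihomog mdeg 0 a \is a GRing.unit.
    by apply: mpdeg_eq0_unit => //; apply: mpdeg_dhomog (pihomogP _ _ _).
  by rewrite -(mulVr cu); apply: PM.
have gP j : g y j \in P 0%N.
  by have [|_] := Ppt 0%N; [lia | apply; apply: fiber_ideal_gen].
have [j0 gj0] := fiber_gen_neq0 y.
have [q qp qP0] : exists2 q, prime_elt q & q \in P 0%N.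
  have := gP j0; move: gj0; move: (g y j0).
  apply: (factorial_ind (@mpoly_factorial k m.+1)) => [u uu uP|p x pp x0 IH].
    have [_ /negP[]] := Pid 0%N m1.
    by rewrite -(mulVr uu); apply: PM.
  by case/(Pprime _ _ _ m1) => [pP|/IH//]; exists p.
(* A prime dividing all the [g y j] would divide the unit [hpoly f y]. So [g y j1] separates [P 0]
   from [(q)]. *)
have [j1 qgj1] : exists j1, ~ divides q (g y j1).
  apply: NNPP => nex; have [_ /(_ q)] := hpolyP y; case=> [j|r rE].
    by apply: NNPP => nq; apply: nex; exists j.
  have : q \is a GRing.unit by apply: (divides_unit_unit hu); exists r.
  by case: qp => _ /negP.
have [q0 qu qprime] := qp.
have [i0 Xi0] : exists i, 'X_i \notin P m.-1.
  by have [|[_ _ _ ?] _] := Ppt m.-1; first by lia.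
pose next i := epsilon (inhabits 0) (fun a => a \in P i.+1 /\ a \notin P i).
have nextP i : (i.+1 < m)%N -> next i \in P i.+1 /\ next i \notin P i.
  move=> im; pose Q a := a \in P i.+1 /\ a \notin P i.
  apply: (epsilon_spec (inhabits (0 : S)) Q).
  by have [|_ [a [? ?]]] := Pstrict i; [lia | exists a].
(* The chain in decreasing order: the polynomials without constant term, [P (m - 1)] down to [P 0],
   then [(q)], then [0]. Below, [x i] lies in [J i] but not in [J i.+1], giving [m + 2] elements in
   [m + 1] variables. *)
pose J i (a : S) : Prop :=
  if i == 0%N then a@_0%MM = 0
  else if (i <= m)%N then is_true (a \in P (m - i)%N)
  else if i == m.+1 then divides q a else a = 0.
pose x i : S :=
  if i == 0%N then 'X_i0 else if (i < m)%N then next (m - i.+1)%N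
  else if i == m then g y j1 else q.
have [Q Q0 QE] := @mpoly_algebraic_dependence k m.+1 (fun i => x i).
have J0E a : J 0%N a = (a@_0%MM = 0) by [].
have JPE i a : (0 < i <= m)%N -> J i a = is_true (a \in P (m - i)%N).
  by case/andP=> i0' im; rewrite /J im eqn0Ngt i0'.
have JqE a : J m.+1 a = divides q a by rewrite /J ltnn eqxx.
have JzE a : J m.+2 a = (a = 0) by rewrite /J ltnNge leqnSn /= gtn_eqF.
have idx i : (i <= m.+2)%N ->
    i = 0%N \/ ((0 < i <= m)%N \/ (i = m.+1 \/ i = m.+2)) by lia.
have x0E : x 0%N = 'X_i0 by [].
have xPE i : (0 < i < m)%N -> x i = next (m - i.+1)%N.
  by case/andP=> i_gt0 im; rewrite /x im eqn0Ngt i_gt0.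
have xmE : x m = g y j1 by rewrite /x ltnn eqxx eqn0Ngt m1.
have xqE : x m.+1 = q by rewrite /x ltnNge leqnSn /= gtn_eqF.
case/eqP: Q0; apply: (@regular_chain_independent k m.+1 J x m.+2).
- move=> i u v /idx[->|[im|[->|->]]]; rewrite ?J0E ?JqE ?JzE ?JPE //.
  + by move=> u0 v0; rewrite mcoeffB u0 v0 subrr.
  + by apply: PD; lia.
  + by move=> qdu qdv; apply: dividesD => //; apply: dividesN.
  + by move=> -> ->; rewrite subrr.
- move=> i u v /idx[->|[im|[->|->]]]; rewrite ?J0E ?JqE ?JzE ?JPE //.
  + by move=> u0; rewrite rmorphM /= u0 mulr0.
  + by apply: PM; lia.
  + exact: divides_mull.
  + by move=> ->; rewrite mulr0.
- move=> i u im2; have /idx[->|[im|[->|]]] : (i <= m.+2)%N by apply: ltnW.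
  + by rewrite JPE ?m1 // J0E; apply: Pconst; lia.
  + rewrite (JPE i) //; have [lt|ge] := ltnP i m.
      rewrite JPE; last by lia.
      have [|sub _] := Pstrict (m - i.+1)%N; first by lia.
      by move=> /sub; rewrite subnSK.
    have -> : i = m by lia.
    by rewrite JqE subnn => -[r ->]; apply: PM.
  + by rewrite JzE JqE => ->; exists 0; rewrite mul0r.
  + by move=> e; move: im2; rewrite e ltnn.
- move=> i im2; have /idx[->|[im|[->|]]] : (i <= m.+2)%N by apply: ltnW.
  + by rewrite J0E x0E mcoeffX mnm1_eq0.
  + rewrite JPE //; have [lt|ge] := ltnP i m.
      by rewrite xPE -?(subnSK lt) //; [apply: (nextP _ _).1 | ]; lia.
    have -> : i = m by lia.
    by rewrite xmE subnn.
  + by rewrite JqE xqE; exists 1; rewrite mul1r.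
  + by move=> e; move: im2; rewrite e ltnn.
- move=> i u im2; have /idx[->|[im|[->|]]] : (i <= m.+2)%N by apply: ltnW.
  + rewrite !JPE ?m1 // x0E subn1 => /Pprime[|//|XP]; first by lia.
    by rewrite XP in Xi0.
  + have [lt|ge] := ltnP i m.
      rewrite !JPE ?xPE; try by lia.
      have [|_ nP] := nextP (m - i.+1)%N; first by lia.
      by move=> /Pprime[|//|nP']; [lia | rewrite nP' in nP].
    have -> : i = m by lia.
    by rewrite !JqE xmE => /qprime[].
  + rewrite !JzE xqE => /eqP; rewrite mulf_eq0 (negbTE q0) orbF.
    by move/eqP.
  + by move=> e; move: im2; rewrite e ltnn.
- by rewrite J0E mcoeff1 eqxx => /eqP; rewrite oner_eq0.
- by rewrite JzE.
Qed.

End Fiber.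

(** * The degree bound and the finiteness of the exceptional set *)

Lemma hpoly_degree_bound (k : fieldType) (m n d : nat)
    (f : 'I_n.+1 -> {mpoly k[m.+1]}) (s nu : nat) (F : {mpoly k[m.+1]}) :
  (2 <= m)%N -> (0 < d)%N -> (forall i, f i \is d.-homog) -> is_gcd f 1 ->
  sat (ideal_exp (ideal_gen f) s) F -> F != 0 -> F \is nu.-homog ->
  (nu < s * d)%N ->
  exists Y : {fset (pspace k n)}, is_Ym1 f Y /\
    (\sum_(y <- Y) mpdeg (hpoly f y) <= nu)%N.
Proof.
move=> m2 d0 fhomog fgcd satF F0 Fnu lt.
(* Stated for arbitrary distinct points, whatever their fibers, so that it is available before the
   finite set [Y] exists. *)
have bound (l : seq (pspace k n)) : uniq l ->
    (\sum_(y <- l) mpdeg (hpoly f y) <= nu)%N.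
  move=> ul; have h0 y : y \in l -> hpoly f y != 0.
    by move=> _; apply: (hpoly_neq0 d0).
  rewrite -(mpdeg_dhomog F0 Fnu) -mpdeg_prod //; apply: mpdeg_divides => //.
  apply: (coprime_prod_divides (@mpoly_factorial k m.+1)) => // [y z _ _|y _].
    exact: (hpoly_coprime d0).
  exact: (hpoly_divides_sat d0 fhomog fgcd y m2 satF Fnu lt).
have [|Y YP] := @fset_of_bounded _ (fun y => fiber_dim f y m.-1) nu.
  move=> l ul lP; apply: leq_trans (bound l ul).
  rewrite -sum1_size !big_seq; apply: leq_sum => y /lP yP.
  by apply: (mpdeg_hpoly_gt0 d0) => //; apply: ltnW.
by exists Y; split=> //; apply: bound; apply: fset_uniq.
Qed.

Theorem theorem2p5 (k : closedFieldType) (m n d : nat)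
    (hm : (2 <= m)%N) (hmn : (m <= n)%N) (hd : (1 <= d)%N)
    (f : 'I_n.+1 -> {mpoly k[m.+1]})
    (fhomog : forall i, f i \is d.-homog)
    (fneq0 : exists i, f i != 0)
    (fgcd : is_gcd f 1)
    (ffin : generically_finite f) :
  (forall s nu : nat, (1 <= s)%N ->
     indeg (sat (ideal_exp (ideal_gen f) s)) nu -> (nu < s * d)%N ->
     exists Y : {fset (pspace k n)}, is_Ym1 f Y /\
       (\sum_(y <- Y) mpdeg (hpoly f y) <= nu < s * d)%N) /\
  (forall nu : nat,
     indeg (sat (ideal_gen f)) nu -> (nu < d)%N ->
     exists Y : {fset (pspace k n)}, is_Ym1 f Y /\
       (\sum_(y <- Y) mpdeg (hpoly f y) < d)%N).
Proof.
split=> [s nu _ [[F [satF F0 Fnu]] _] lt|nu [[F [[e satF] F0 Fnu]] _] lt].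
  have [Y [YP sumY]] := hpoly_degree_bound hm hd fhomog fgcd satF F0 Fnu lt.
  by exists Y; rewrite sumY.
have satF1 : sat (ideal_exp (ideal_gen f) 1) F.
  by exists e => a /satF; apply: ideal_exp1_mem.
have [|Y [YP sumY]] := hpoly_degree_bound hm hd fhomog fgcd satF1 F0 Fnu.
  by rewrite mul1n.
by exists Y; split=> //; apply: leq_ltn_trans sumY lt.
Qed.
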